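(* Let $\phi$ be a quantum channel (completely positive, trace-preserving linear map) acting on $d\times d$ complex matrices (system $A$, $d<\infty$). Then $\phi$ is universal entanglement-preserving if and only if $\phi$ is a unitary evolution, i.e. there is a unitary $U$ with $\phi(X)=UXU^\dagger$ for all $X$.
   Context: A channel $\phi$ on system $A$ is universal entanglement-preserving (UEP) if for every finite-dimensional quantum system $B$ and every entangled (non-separable) state $\rho_{AB}$ on $AB$, the state $(\phi\otimes I)(\rho_{AB})$ is again entangled, where $I$ is the identity map on $B$. *)

(* Defs.v *)
From HB Require Import structures.
From mathcomp Require Import all_boot all_order all_algebra.
Set Implicit Arguments. Unset Strict Implicit. Unset Printing Implicit Defensive.
Import Order.TTheory GRing.Theory Num.Theory Num.Def.
Local Open Scope ring_scope.

Section QI.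
Variable C : numClosedFieldType.

Definition adjmx m n (M : 'M[C]_(m, n)) : 'M[C]_(n, m) := map_mx conjC (M ^T).

Definition psd n (A : 'M[C]_n) : Prop :=
  adjmx A = A /\ forall v : 'cV[C]_n, 0 <= (adjmx v *m A *m v) 0 0.

Definition is_state n (A : 'M[C]_n) : Prop := psd A /\ \tr A = 1.

Definition kron d m (A : 'M[C]_d) (B : 'M[C]_m) : 'M[C]_(d * m) :=
  \sum_(i < d) \sum_(j < d) \sum_(a < m) \sum_(b < m)
     (A i j * B a b) *: delta_mx (mxvec_index i a) (mxvec_index j b).

(* block (a,b) of an operator on AB, i.e. the operator on A given by
   rho_{ab} with rho = \sum_{a,b} rho_{ab} (x) |a><b| *)
Definition blk d m (rho : 'M[C]_(d * m)) (a b : 'I_m) : 'M[C]_d :=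
  \matrix_(i, j) rho (mxvec_index i a) (mxvec_index j b).

(* (phi (x) id_B) rho *)
Definition ampl d m (phi : 'M[C]_d -> 'M[C]_d) (rho : 'M[C]_(d * m))
  : 'M[C]_(d * m) :=
  \sum_(a < m) \sum_(b < m) kron (phi (blk rho a b)) (delta_mx a b).

Definition separable d m (rho : 'M[C]_(d * m)) : Prop :=
  exists k (p : 'I_k -> C) (rA : 'I_k -> 'M[C]_d) (rB : 'I_k -> 'M[C]_m),
    [/\ forall l, 0 <= p l, \sum_(l < k) p l = 1,
        forall l, is_state (rA l) /\ is_state (rB l)
      & rho = \sum_(l < k) p l *: kron (rA l) (rB l)].

Definition entangled d m (rho : 'M[C]_(d * m)) : Prop :=
  is_state rho /\ ~ separable rho.

Definition completely_positive d (phi : 'M[C]_d -> 'M[C]_d) : Prop :=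
  forall (m : nat) (rho : 'M[C]_(d * m)), psd rho -> psd (ampl phi rho).

Definition trace_preserving d (phi : 'M[C]_d -> 'M[C]_d) : Prop :=
  forall X, \tr (phi X) = \tr X.

Definition quantum_channel d (phi : 'M[C]_d -> 'M[C]_d) : Prop :=
  [/\ linear phi, completely_positive phi & trace_preserving phi].

Definition UEP d (phi : 'M[C]_d -> 'M[C]_d) : Prop :=
  forall (m : nat) (rho : 'M[C]_(d * m)), entangled rho -> entangled (ampl phi rho).

Definition unitary_evolution d (phi : 'M[C]_d -> 'M[C]_d) : Prop :=
  exists U : 'M[C]_d, U *m adjmx U = 1%:M /\ forall X, phi X = U *m X *m adjmx U.

End QI.

(* Main.v *)
Require Import Defs.
From HB Require Import structures.
From mathcomp Require Import all_boot all_order all_algebra.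
From mathcomp Require Import ring.
Set Implicit Arguments. Unset Strict Implicit. Unset Printing Implicit Defensive.
Import Order.TTheory GRing.Theory Num.Theory Num.Def.
Local Open Scope ring_scope.

(* Let phi be a UEP channel with Kraus operators K_i, and let x <> 0 be such that
   some y orthogonal to x has the same norm.  If phi(|x|^2 - x x^* ) had the same
   support as phi(1), consider the operator
     c (|x|^2 - x x^* ) (x) x x^* + b sum_k a_k a_k^* (x) b_k b_k^* - x x^* (x) x x^*
   with large b, c, where the a_k (x) b_k are four product vectors with
   <a_k, b_k> = 0 whose span contains x (x) x.  It is positive, and entangled
   because its pairing with the swap operator is negative; but the first and last
   terms have image (c phi(|x|^2 - x x^* ) - phi(x x^* )) (x) x x^*, so its image
   under phi is separable.  Hence there is h with h K_i = g_i x^* for all i, not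
   all g_i zero.  Taking for x the basis vectors e_j shows that the K_i are
   simultaneously of the form G^-1 diag(g_i), and taking x = e_0 + e_k shows that
   these diagonal matrices are proportional.  So phi(X) = U X U^*, and U is unitary
   by trace preservation. *)

(** * Positive semidefinite matrices *)

Section Positivity.
Variable C : numClosedFieldType.

Lemma adjmxE m n (M : 'M[C]_(m, n)) i j : adjmx M i j = (M j i)^*.
Proof. by rewrite !mxE. Qed.

Lemma adjmxK m n (M : 'M[C]_(m, n)) : adjmx (adjmx M) = M.
Proof. by apply/matrixP=> i j; rewrite !adjmxE conjCK. Qed.

Lemma adjmx_inj m n : injective (@adjmx C m n).
Proof. exact: can_inj (@adjmxK m n). Qed.

Lemma adjmxM m n p (M : 'M[C]_(m, n)) (N : 'M_(n, p)) :
  adjmx (M *m N) = adjmx N *m adjmx M.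
Proof. by rewrite /adjmx trmx_mul map_mxM. Qed.

Lemma adjmxD m n (M N : 'M[C]_(m, n)) : adjmx (M + N) = adjmx M + adjmx N.
Proof. by rewrite /adjmx linearD map_mxD. Qed.

Lemma adjmxN m n (M : 'M[C]_(m, n)) : adjmx (- M) = - adjmx M.
Proof. by rewrite /adjmx linearN map_mxN. Qed.

Lemma adjmxB m n (M N : 'M[C]_(m, n)) : adjmx (M - N) = adjmx M - adjmx N.
Proof. by rewrite adjmxD adjmxN. Qed.

Lemma adjmxZ m n c (M : 'M[C]_(m, n)) : adjmx (c *: M) = c^* *: adjmx M.
Proof. by rewrite /adjmx linearZ map_mxZ. Qed.

Lemma adjmx0 m n : adjmx (0 : 'M[C]_(m, n)) = 0.
Proof. by rewrite /adjmx trmx0 map_mx0. Qed.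

Lemma adjmx1 n : adjmx (1%:M : 'M[C]_n) = 1%:M.
Proof. by rewrite /adjmx trmx1 map_mx1. Qed.

Lemma adjmx_delta m n i j :
  adjmx (delta_mx i j : 'M[C]_(m, n)) = delta_mx j i.
Proof. by apply/matrixP=> a b; rewrite !mxE andbC rmorph_nat. Qed.

Lemma scal_mx11 n (x : 'M[C]_(n, 1)) (a : 'M[C]_1) : x *m a = a 0 0 *: x.
Proof. by rewrite [a]mx11_scalar mul_mx_scalar mxE. Qed.

Lemma trace_gramE m n (M : 'M[C]_(m, n)) :
  \tr (M *m adjmx M) = \sum_i \sum_j `|M i j| ^+ 2.
Proof.
rewrite /mxtrace; apply: eq_bigr => i _; rewrite mxE; apply: eq_bigr => j _.
by rewrite adjmxE normCK.
Qed.

Lemma trace_gram_ge0 m n (M : 'M[C]_(m, n)) : 0 <= \tr (M *m adjmx M).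
Proof.
rewrite trace_gramE; apply: sumr_ge0 => i _; apply: sumr_ge0 => j _.
by rewrite exprn_ge0.
Qed.

Lemma trace_gram_eq0 m n (M : 'M[C]_(m, n)) : \tr (M *m adjmx M) = 0 -> M = 0.
Proof.
rewrite trace_gramE => s0; apply/matrixP => i j; rewrite mxE.
have ge0 k l : 0 <= `|M k l| ^+ 2 by rewrite exprn_ge0.
have si : \sum_l `|M i l| ^+ 2 = 0.
  by apply: (psumr_eq0P _ s0) => // k _; apply: sumr_ge0.
have : `|M i j| ^+ 2 = 0 by apply: (psumr_eq0P _ si).
by move/eqP; rewrite sqrf_eq0 normr_eq0 => /eqP.
Qed.

Lemma psd_gram m n (M : 'M[C]_(m, n)) : psd (M *m adjmx M).
Proof.
split=> [|v]; first by rewrite adjmxM adjmxK.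
have := trace_gram_ge0 (adjmx v *m M); rewrite /mxtrace big_ord1.
by rewrite adjmxM adjmxK !mulmxA.
Qed.

Lemma psd0 n : psd (0 : 'M[C]_n).
Proof. by have := psd_gram (0 : 'M[C]_(n, n)); rewrite mul0mx. Qed.

Lemma psdD n (A B : 'M[C]_n) : psd A -> psd B -> psd (A + B).
Proof.
move=> [hA pA] [hB pB]; split; first by rewrite adjmxD hA hB.
by move=> v; rewrite mulmxDr mulmxDl mxE addr_ge0.
Qed.

Lemma psd_sum n (I : Type) (r : seq I) (P : pred I) (A : I -> 'M[C]_n) :
  (forall i, P i -> psd (A i)) -> psd (\sum_(i <- r | P i) A i).
Proof. by move=> pA; apply: big_ind => //; [exact: psd0 | exact: psdD]. Qed.

Lemma psdZ n c (A : 'M[C]_n) : 0 <= c -> psd A -> psd (c *: A).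
Proof.
move=> c0 [hA pA]; split; first by rewrite adjmxZ hA geC0_conj.
by move=> v; rewrite -scalemxAr -scalemxAl mxE mulr_ge0.
Qed.

Lemma psd_congr m n (M : 'M[C]_(m, n)) (A : 'M[C]_n) :
  psd A -> psd (M *m A *m adjmx M).
Proof.
move=> [hA pA]; split; first by rewrite !adjmxM adjmxK hA mulmxA.
by move=> v; have := pA (adjmx M *m v); rewrite adjmxM adjmxK !mulmxA.
Qed.

Lemma psd_diag_ge0 n (A : 'M[C]_n) i : psd A -> 0 <= A i i.
Proof.
case=> _ /(_ (delta_mx i 0)); rewrite adjmx_delta -rowE.
by rewrite mxE (bigD1 i) //= !mxE !eqxx mulr1 big1 ?addr0 // => j /negPf nj;
  rewrite !mxE nj mulr0.
Qed.

(** Spectral theorem: the eigenvalues are diagonal entries of P A P^*, hence nonnegative, and N is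
    P^* times the diagonal matrix of their square roots. *)
Lemma psd_factor n (A : 'M[C]_n) :
  psd A -> exists N : 'M[C]_n, A = N *m adjmx N.
Proof.
move=> pA; have [hA _] := pA.
have An : A \is normalmx.
  by apply/normalmxP; change (A *m adjmx A = adjmx A *m A); rewrite hA.
have /orthomx_spectralP := An.
set P := spectralmx A; set X := spectral_diag A => AE.
have PU : P \is unitarymx := spectral_unitarymx A.
have iP : invmx P = adjmx P by rewrite (invmx_unitary PU).
have PP : P *m adjmx P = 1%:M by rewrite -iP mulmxV // unitarymx_unit.
have XE : diag_mx X = P *m A *m adjmx P.
  by rewrite AE iP !mulmxA PP mul1mx -mulmxA PP mulmx1.
have X0 i : 0 <= X 0 i.
  have := psd_diag_ge0 i (psd_congr P pA); rewrite -XE.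
  by rewrite !mxE eqxx mulr1n.
exists (adjmx P *m diag_mx (\row_i sqrtC (X 0 i))).
rewrite adjmxM adjmxK mulmxA -[in RHS](mulmxA (adjmx P)).
rewrite [in LHS]AE iP; congr (_ *m _ *m _).
set r := \row_i _; have -> : adjmx (diag_mx r) = diag_mx r.
  rewrite /adjmx tr_diag_mx map_diag_mx; congr diag_mx; apply/rowP => i.
  by rewrite !mxE /=; apply: geC0_conj; rewrite sqrtC_ge0.
rewrite mulmx_diag; congr diag_mx; apply/rowP => i.
by rewrite !mxE -expr2 sqrtCK.
Qed.

Lemma psd_trace_ge0 n (A : 'M[C]_n) : psd A -> 0 <= \tr A.
Proof. by case/psd_factor=> N ->; exact: trace_gram_ge0. Qed.

Lemma psd_trace_eq0 n (A : 'M[C]_n) : psd A -> \tr A = 0 -> A = 0.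
Proof. by case/psd_factor=> N -> /trace_gram_eq0 ->; rewrite mul0mx. Qed.

Lemma psd_tracemul_ge0 n (A B : 'M[C]_n) : psd A -> psd B -> 0 <= \tr (A *m B).
Proof.
case/psd_factor=> M ->; case/psd_factor=> N ->.
rewrite -mulmxA mxtrace_mulC -!mulmxA.
have -> : adjmx M *m (N *m (adjmx N *m M))
        = (adjmx M *m N) *m adjmx (adjmx M *m N) by rewrite adjmxM adjmxK !mulmxA.
exact: trace_gram_ge0.
Qed.

Definition sqnorm n (x : 'cV[C]_n) : C := (adjmx x *m x) 0 0.

Lemma sqnorm_trace n (x : 'cV[C]_n) : sqnorm x = \tr (x *m adjmx x).
Proof. by rewrite mxtrace_mulC /mxtrace big_ord1. Qed.

Lemma sqnorm_ge0 n (x : 'cV[C]_n) : 0 <= sqnorm x.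
Proof. by rewrite sqnorm_trace trace_gram_ge0. Qed.

Lemma sqnorm_eq0 n (x : 'cV[C]_n) : sqnorm x = 0 -> x = 0.
Proof. by rewrite sqnorm_trace => /trace_gram_eq0. Qed.

(* For x <> 0, |x|^2 times the orthogonal projection onto the complement of x. *)
Definition perp n (x : 'cV[C]_n) : 'M[C]_n := (sqnorm x)%:M - x *m adjmx x.

Lemma adjmx_perp n (x : 'cV[C]_n) : adjmx (perp x) = perp x.
Proof.
by rewrite /perp adjmxB adjmxM adjmxK -scalemx1 adjmxZ adjmx1 geC0_conj ?sqnorm_ge0.
Qed.

(** A Hermitian multiple |x|^2 of a projection squares to |x|^2 times itself; in this division-free
    form the identity also covers x = 0. *)
Lemma perp_gram n (x : 'cV[C]_n) : sqnorm x *: perp x = perp x *m adjmx (perp x).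
Proof.
rewrite adjmx_perp {2}/perp mulmxBl mul_scalar_mx.
have -> : x *m adjmx x *m perp x = 0; last by rewrite subr0.
rewrite /perp mulmxBr mul_mx_scalar mulmxA -(mulmxA x) scal_mx11 -scalemxAl.
exact: subrr.
Qed.

Lemma psd_perp n (x : 'cV[C]_n) : psd (perp x).
Proof.
have [/sqnorm_eq0 x0|nx] := eqVneq (sqnorm x) 0.
  rewrite /perp /sqnorm x0 mulmx0 mul0mx mxE subr0 -scalemx1 scale0r; exact: psd0.
rewrite -[perp x]scale1r -(mulVf nx) -scalerA perp_gram.
by apply: psdZ (psd_gram _); rewrite invr_ge0 sqnorm_ge0.
Qed.

Lemma gram_colE m n (M : 'M[C]_(m, n)) :
  M *m adjmx M = \sum_k col k M *m adjmx (col k M).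
Proof.
apply/matrixP => i j; rewrite mxE summxE; apply: eq_bigr => k _.
by rewrite [RHS]mxE big_ord1 !mxE.
Qed.

(** Column by column, the difference is the sum of the operators [perp] of the columns of T. *)
Lemma psd_trace_sub_gram m n (T : 'M[C]_(m, n)) :
  psd ((\tr (T *m adjmx T))%:M - T *m adjmx T).
Proof.
rewrite gram_colE [\tr _]raddf_sum /= -scalemx1 scaler_suml -sumrB; apply: psd_sum => k _.
by rewrite scalemx1 -sqnorm_trace; exact: psd_perp.
Qed.

(* The range of M lies in that of N N^*, so M = N T for some T, and
   T T^* <= tr (T T^* ). *)
Lemma psd_dominate m n p (N : 'M[C]_(m, n)) (M : 'M[C]_(m, p)) :
  M *m adjmx M *m cokermx (N *m adjmx N) = 0 ->
  exists2 c, 0 <= c & psd (c *: (N *m adjmx N) - M *m adjmx M).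
Proof.
set A := N *m adjmx N; set K := cokermx A => MK.
(* The trace of K^* M M^* K vanishes, so M^* K = 0. *)
have M0 : adjmx M *m K = 0.
  apply: adjmx_inj; rewrite adjmx0; apply: trace_gram_eq0.
  by rewrite adjmxK adjmxM adjmxK -(mulmxA _ M) (mulmxA M) MK mulmx0 mxtrace0.
have /submxP [D DE] : (adjmx M <= A)%MS by rewrite submxE M0.
have ME : M = N *m (adjmx N *m adjmx D).
  by rewrite -[M]adjmxK DE adjmxM /A adjmxM adjmxK !mulmxA.
set T := adjmx N *m adjmx D in ME; exists (\tr (T *m adjmx T)).
  exact: trace_gram_ge0.
have := psd_congr N (psd_trace_sub_gram T).
rewrite mulmxBr mulmxBl mul_mx_scalar -scalemxAl ME adjmxM.
by rewrite /A !mulmxA.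
Qed.

End Positivity.

(** * Tensor products and separability *)

Section Tensor.
Variable C : numClosedFieldType.

(** Channels are bare functions with a proof of linearity; packing them here gives access to the
    rules for linear maps. *)
Lemma linear_morph (V : lmodType C) (f : V -> V) : linear f ->
  [/\ {morph f : u v / u + v}, {morph f : u v / u - v}
    & forall k, {morph f : u / k *: u}].
Proof.
move=> lf; pose F : {linear V -> V} := HB.pack f (GRing.isLinear.Build _ _ _ _ f lf).
by split; [exact: (linearD F) | exact: (linearB F) | exact: (linearZ_LR F)].
Qed.

Lemma mxvec_index_eq d m (i j : 'I_d) (a b : 'I_m) :
  (mxvec_index i a == mxvec_index j b) = (i == j) && (a == b).
Proof.
by rewrite (inj_eq (@cast_ord_inj _ _ _)) (inj_eq enum_rank_inj) xpair_eqE.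
Qed.

Lemma tensor_matrixP d m (A B : 'M[C]_(d * m)) :
  (forall i a j b, A (mxvec_index i a) (mxvec_index j b)
                 = B (mxvec_index i a) (mxvec_index j b)) -> A = B.
Proof.
by move=> AB; apply/matrixP => k l; case/mxvec_indexP: k => i a; case/mxvec_indexP: l.
Qed.

Lemma sum_mxvec_index d m (F : 'I_(d * m) -> C) :
  \sum_k F k = \sum_i \sum_a F (mxvec_index i a).
Proof.
rewrite (reindex _ (curry_mxvec_bij d m)) pair_bigA /=.
by apply: eq_bigr => -[].
Qed.

Lemma kronE d m (A : 'M[C]_d) (B : 'M_m) i a j b :
  kron A B (mxvec_index i a) (mxvec_index j b) = A i j * B a b.
Proof.
rewrite /kron summxE (bigD1 i) //= [X in _ + X]big1 ?addr0; last first.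
  move=> i' ni; rewrite summxE big1 // => j' _; rewrite summxE big1 // => a' _.
  rewrite summxE big1 // => b' _.
  by rewrite !mxE !mxvec_index_eq [i == i']eq_sym (negPf ni) mulr0.
rewrite summxE (bigD1 j) //= [X in _ + X]big1 ?addr0; last first.
  move=> j' nj; rewrite summxE big1 // => a' _; rewrite summxE big1 // => b' _.
  by rewrite !mxE !mxvec_index_eq [j == j']eq_sym (negPf nj) andbF mulr0.
rewrite summxE (bigD1 a) //= [X in _ + X]big1 ?addr0; last first.
  move=> a' na; rewrite summxE big1 // => b' _.
  by rewrite !mxE !mxvec_index_eq [a == a']eq_sym (negPf na) andbF mulr0.
rewrite summxE (bigD1 b) //= [X in _ + X]big1 ?addr0; last first.
  move=> b' nb.
  by rewrite !mxE !mxvec_index_eq [b == b']eq_sym (negPf nb) !andbF mulr0.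
by rewrite !mxE !mxvec_index_eq !eqxx mulr1.
Qed.

Lemma trace_kron d m (A : 'M[C]_d) (B : 'M_m) : \tr (kron A B) = \tr A * \tr B.
Proof.
rewrite /mxtrace sum_mxvec_index mulr_suml; apply: eq_bigr => i _.
by rewrite mulr_sumr; apply: eq_bigr => a _; rewrite kronE.
Qed.

Lemma kronZl d m c (A : 'M[C]_d) (B : 'M_m) : kron (c *: A) B = c *: kron A B.
Proof. by apply: tensor_matrixP => i a j b; rewrite !(kronE, mxE) mulrA. Qed.

Lemma kronZr d m c (A : 'M[C]_d) (B : 'M_m) : kron A (c *: B) = c *: kron A B.
Proof. by apply: tensor_matrixP => i a j b; rewrite !(kronE, mxE) mulrCA. Qed.

Lemma kronBl d m (A A' : 'M[C]_d) (B : 'M_m) :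
  kron (A - A') B = kron A B - kron A' B.
Proof. by apply: tensor_matrixP => i a j b; rewrite !(kronE, mxE) mulrBl. Qed.

Definition tens d m (x : 'cV[C]_d) (y : 'cV[C]_m) : 'cV[C]_(d * m) :=
  (mxvec (x *m y^T))^T.

Lemma tensE d m (x : 'cV[C]_d) (y : 'cV[C]_m) i a k :
  tens x y (mxvec_index i a) k = x i 0 * y a 0.
Proof. by rewrite [k]ord1 mxE mxvecE mxE big_ord1 mxE. Qed.

Lemma tensP d m (u v : 'cV[C]_(d * m)) :
  (forall i a, u (mxvec_index i a) 0 = v (mxvec_index i a) 0) -> u = v.
Proof. by move=> uv; apply/colP => k; case/mxvec_indexP: k. Qed.

Lemma kron_rank1 d m (x : 'cV[C]_d) (y : 'cV[C]_m) :
  kron (x *m adjmx x) (y *m adjmx y) = tens x y *m adjmx (tens x y).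
Proof.
apply: tensor_matrixP => i a j b; rewrite kronE [RHS]mxE big_ord1 adjmxE !tensE.
by rewrite !mxE !big_ord1 !adjmxE rmorphM mulrACA.
Qed.

(** Both factors are sums of rank-one Gram matrices, and the product of two such terms is the Gram
    matrix of a product vector. *)
Lemma psd_kron d m (A : 'M[C]_d) (B : 'M_m) : psd A -> psd B -> psd (kron A B).
Proof.
case/psd_factor=> M ->; case/psd_factor=> N ->; rewrite !gram_colE.
have -> : kron (\sum_k col k M *m adjmx (col k M)) (\sum_l col l N *m adjmx (col l N))
   = \sum_k \sum_l kron (col k M *m adjmx (col k M)) (col l N *m adjmx (col l N)).
  apply: tensor_matrixP => i a j b; rewrite kronE !summxE mulr_suml.
  apply: eq_bigr => k _; rewrite summxE mulr_sumr; apply: eq_bigr => l _.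
  by rewrite kronE.
apply: psd_sum => k _; apply: psd_sum => l _; rewrite kron_rank1; exact: psd_gram.
Qed.

(** * Amplified maps *)

Lemma amplE d m (phi : 'M[C]_d -> 'M[C]_d) (rho : 'M_(d * m)) i a j b :
  ampl phi rho (mxvec_index i a) (mxvec_index j b) = phi (blk rho a b) i j.
Proof.
rewrite /ampl summxE (bigD1 a) //= [X in _ + X]big1 ?addr0; last first.
  move=> a' na; rewrite summxE big1 // => b' _.
  by rewrite kronE !mxE [a == a']eq_sym (negPf na) mulr0.
rewrite summxE (bigD1 b) //= [X in _ + X]big1 ?addr0; last first.
  by move=> b' nb; rewrite kronE !mxE [b == b']eq_sym (negPf nb) andbF mulr0.
by rewrite kronE !mxE !eqxx mulr1.
Qed.

Lemma blk_is_linear d m a b :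
  linear (fun rho : 'M[C]_(d * m) => blk rho a b).
Proof. by move=> c rho sigma; apply/matrixP => i j; rewrite !mxE. Qed.

Lemma blk_kron d m (A : 'M[C]_d) (B : 'M_m) a b : blk (kron A B) a b = B a b *: A.
Proof. by apply/matrixP => i j; rewrite !mxE kronE mulrC. Qed.

Lemma trace_ampl d m (phi : 'M[C]_d -> 'M[C]_d) (rho : 'M_(d * m)) :
  trace_preserving phi -> \tr (ampl phi rho) = \tr rho.
Proof.
move=> tp; rewrite /mxtrace !sum_mxvec_index exchange_big [RHS]exchange_big /=.
apply: eq_bigr => a _; transitivity (\tr (phi (blk rho a a))).
  by apply: eq_bigr => i _; rewrite amplE.
by rewrite tp; apply: eq_bigr => i _; rewrite mxE.
Qed.

Lemma ampl_is_linear d m (phi : 'M[C]_d -> 'M[C]_d) :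
  linear phi -> linear (@ampl C d m phi).
Proof.
move=> lphi c rho sigma; apply: tensor_matrixP => i a j b.
by rewrite ![in RHS]mxE !amplE blk_is_linear lphi !mxE.
Qed.

Lemma ampl_kron d m (phi : 'M[C]_d -> 'M[C]_d) (A : 'M_d) (B : 'M_m) :
  linear phi -> ampl phi (kron A B) = kron (phi A) B.
Proof.
move=> lphi; apply: tensor_matrixP => i a j b.
rewrite amplE blk_kron kronE.
by have [_ _ ->] := linear_morph lphi; rewrite mxE mulrC.
Qed.

Lemma ampl_cancel d m (phi psi : 'M[C]_d -> 'M[C]_d) (rho : 'M_(d * m)) :
  cancel phi psi -> ampl psi (ampl phi rho) = rho.
Proof.
move=> phiK; apply: tensor_matrixP => i a j b; rewrite amplE.
have -> : blk (ampl phi rho) a b = phi (blk rho a b).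
  by apply/matrixP => i' j'; rewrite mxE amplE.
by rewrite phiK mxE.
Qed.

(** This is tr (F rho) for the swap operator F, which serves as entanglement witness. *)
Definition swap_pairing d (rho : 'M[C]_(d * d)) : C :=
  \sum_i \sum_j rho (mxvec_index i j) (mxvec_index j i).

Lemma swap_pairing_is_linear d : linear_for *%R (@swap_pairing d).
Proof.
move=> c rho sigma; rewrite /swap_pairing mulr_sumr -big_split; apply: eq_bigr => i _.
by rewrite mulr_sumr -big_split; apply: eq_bigr => j _; rewrite !mxE.
Qed.

HB.instance Definition _ d :=
  GRing.isLinear.Build C 'M[C]_(d * d) C *%R (@swap_pairing d) (@swap_pairing_is_linear d).

Lemma swap_pairing_kron d (A B : 'M[C]_d) : swap_pairing (kron A B) = \tr (A *m B).
Proof.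
rewrite /swap_pairing /mxtrace; apply: eq_bigr => i _; rewrite mxE.
by apply: eq_bigr => j _; rewrite kronE.
Qed.

Lemma swap_pairing_separable d (rho : 'M[C]_(d * d)) :
  separable rho -> 0 <= swap_pairing rho.
Proof.
case=> k [p [rA [rB [p0 _ st ->]]]]; rewrite linear_sum sumr_ge0 // => l _.
rewrite linearZ /= swap_pairing_kron mulr_ge0 //.
by case: (st l) => -[pA _] [pB _]; exact: psd_tracemul_ge0.
Qed.

(** Unnormalized separable operators: without weights and traces, sums and scalings are immediate,
    and normalization is done once, in [sep_cone_separable]. *)
Definition sep_cone d m (rho : 'M[C]_(d * m)) : Prop :=
  exists s : seq ('M[C]_d * 'M[C]_m),
    (forall q, q \in s -> psd q.1 /\ psd q.2) /\ rho = \sum_(q <- s) kron q.1 q.2.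

Lemma sep_cone_kron d m (A : 'M[C]_d) (B : 'M_m) :
  psd A -> psd B -> sep_cone (kron A B).
Proof.
move=> pA pB; exists [:: (A, B)]; split; last by rewrite big_seq1.
by move=> q; rewrite inE => /eqP ->.
Qed.

Lemma sep_coneD d m (rho sigma : 'M[C]_(d * m)) :
  sep_cone rho -> sep_cone sigma -> sep_cone (rho + sigma).
Proof.
move=> [s [ps ->]] [t [pt ->]]; exists (s ++ t); split; last by rewrite big_cat.
by move=> q; rewrite mem_cat => /orP []; [exact: ps | exact: pt].
Qed.

Lemma sep_coneZ d m c (rho : 'M[C]_(d * m)) :
  0 <= c -> sep_cone rho -> sep_cone (c *: rho).
Proof.
move=> c0 [s [ps ->]]; exists [seq (c *: q.1, q.2) | q <- s]; split.
  by move=> _ /mapP [q /ps [p1 p2] ->]; split=> //=; exact: psdZ.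
by rewrite big_map scaler_sumr; apply: eq_bigr => q _; rewrite kronZl.
Qed.

Lemma psd_normalize n (A : 'M[C]_n) :
  psd A -> \tr A != 0 -> is_state ((\tr A)^-1 *: A).
Proof.
move=> pA tA; split; last by rewrite linearZ /= mulVf.
by apply: (psdZ _ pA); rewrite invr_ge0 psd_trace_ge0.
Qed.

Lemma state_exists n : (0 < n)%N -> exists A : 'M[C]_n, is_state A.
Proof.
case: n => // n _; exists ((\tr (1%:M : 'M[C]_n.+1))^-1 *: 1%:M).
apply: psd_normalize; last by rewrite mxtrace1 pnatr_eq0.
by have := psd_gram (1%:M : 'M[C]_n.+1); rewrite adjmx1 mulmx1.
Qed.

Lemma sep_cone_separable d m (rho : 'M[C]_(d * m)) :
  sep_cone rho -> \tr rho = 1 -> separable rho.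
Proof.
move=> [s [ps rhoE]] tr1.
have dm : (0 < d * m)%N.
  case: posnP => // dm; move: tr1; rewrite /mxtrace big1 => [/esym/eqP|k _].
    by rewrite oner_eq0.
  by have := ltn_ord k; rewrite {2}dm.
have [/state_exists [A0 sA0] /state_exists [B0 sB0]] : (0 < d)%N /\ (0 < m)%N.
  by apply/andP; rewrite -muln_gt0.
pose q (l : 'I_(size s)) := tnth (in_tuple s) l.
have pq l : psd (q l).1 /\ psd (q l).2 by apply/ps/mem_tnth.
pose p l := \tr (q l).1 * \tr (q l).2.
(* A term of weight zero cannot be normalized; it is itself zero, so arbitrary states take its
   place. *)
pose rA l := if p l == 0 then A0 else (\tr (q l).1)^-1 *: (q l).1.
pose rB l := if p l == 0 then B0 else (\tr (q l).2)^-1 *: (q l).2.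
have pkron l : psd (kron (q l).1 (q l).2).
  by have [p1 p2] := pq l; exact: psd_kron.
exists (size s), p, rA, rB; split.
- by move=> l; have [p1 p2] := pq l; rewrite mulr_ge0 ?psd_trace_ge0.
- rewrite -tr1 rhoE linear_sum [RHS]big_tnth /=; apply: eq_bigr => l _.
  by rewrite trace_kron.
- move=> l; have [p1 p2] := pq l; rewrite /rA /rB; case: eqVneq => // /[!mulf_eq0].
  by rewrite negb_or => /andP [t1 t2]; split; exact: psd_normalize.
rewrite rhoE [LHS]big_tnth; apply: eq_bigr => l _; rewrite /rA /rB -/(q l).
have [pl|] := eqVneq (p l) 0.
  by rewrite pl scale0r; apply: psd_trace_eq0 (pkron l) _; rewrite trace_kron.
move=> pl; have /[!mulf_eq0] := pl; rewrite negb_or => /andP [t1 t2].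
by rewrite kronZl kronZr !scalerA -mulrA -invfM -/(p l) mulfV ?scale1r.
Qed.

(** The negative pairing makes the normalized rho entangled, so its image must be entangled too and
    cannot lie in the separable cone. *)
Lemma UEP_swap_contra d (phi : 'M[C]_d -> 'M[C]_d) (rho : 'M[C]_(d * d)) :
  linear phi -> trace_preserving phi -> UEP phi ->
  psd rho -> swap_pairing rho < 0 -> ~ sep_cone (ampl phi rho).
Proof.
move=> lphi tp uep prho neg sep.
have t0 : \tr rho != 0.
  by apply: contraTneq neg => /(psd_trace_eq0 prho) ->; rewrite linear0 ltxx.
have ti : 0 <= (\tr rho)^-1 by rewrite invr_ge0 psd_trace_ge0.
have ti0 : 0 < (\tr rho)^-1 by rewrite lt_def ti invr_eq0 t0.
have ent : entangled ((\tr rho)^-1 *: rho).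
  split; first exact: psd_normalize.
  move=> /swap_pairing_separable; rewrite linearZ /= pmulr_rge0 //.
  by rewrite lt_geF.
have [[_ tr1] nsep] := uep _ _ ent; apply: nsep.
apply: sep_cone_separable tr1.
by have [_ _ ->] := linear_morph (@ampl_is_linear d d phi lphi); apply: sep_coneZ.
Qed.

End Tensor.

(** * Consequences of entanglement preservation *)

Section Channel.
Variable C : numClosedFieldType.

(** For positive A this means that u lies in the range of A. *)
Definition dominates n (A : 'M[C]_n) (u : 'cV[C]_n) : Prop :=
  exists2 c, 0 <= c & psd (c *: A - u *m adjmx u).

Lemma dominatesD n (A : 'M[C]_n) u v :
  dominates A u -> dominates A v -> dominates A (u + v).
Proof.
(* Parallelogram law: the rank-one operators of u + v and u - v add up to twice those of u and v. *)
move=> [b b0 pb] [c c0 pc]; exists (2 * (b + c)); first by rewrite mulr_ge0 ?addr_ge0.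
have -> : (2 * (b + c)) *: A - (u + v) *m adjmx (u + v)
  = 2 *: (b *: A - u *m adjmx u) + 2 *: (c *: A - v *m adjmx v)
    + (u - v) *m adjmx (u - v).
  rewrite adjmxD adjmxB !(mulmxDl, mulmxDr, mulNmx, mulmxN).
  by apply/matrixP => i j; rewrite !mxE; ring.
by apply: psdD (psd_gram _); apply: psdD; exact: psdZ.
Qed.

Lemma dominatesZ n (A : 'M[C]_n) k u : dominates A u -> dominates A (k *: u).
Proof.
move=> [c c0 pc]; exists (`|k| ^+ 2 * c); first by rewrite mulr_ge0 ?exprn_ge0.
rewrite adjmxZ -scalemxAl -scalemxAr scalerA -normCK -scalerA -scalerBr.
by apply: psdZ pc; rewrite exprn_ge0.
Qed.

Lemma dominates_gramD n (A : 'M[C]_n) u : psd A -> dominates (u *m adjmx u + A) u.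
Proof. by move=> pA; exists 1 => //; rewrite scale1r addrC addKr. Qed.

Lemma swap_pairing_rank1 d (x y : 'cV[C]_d) : adjmx x *m y = 0 ->
  swap_pairing (kron (x *m adjmx x) (y *m adjmx y)) = 0.
Proof.
by move=> xy; rewrite swap_pairing_kron mulmxA -(mulmxA x) xy mulmx0 mul0mx mxtrace0.
Qed.

(* For orthogonal x and y of equal norm, all four product vectors a (x) b on the
   right satisfy <a, b> = 0. *)
Lemma tens_square_orthogonal d (x y : 'cV[C]_d) :
  tens x x = 2^-1 *: (tens (x + y) (x - y) + tens (x + 'i *: y) (x - 'i *: y))
    + ((1 + 'i) / 2) *: (tens x y + (-1) *: tens y x).
Proof.
apply: tensP => i a; rewrite !(tensE, mxE).
move: (x i 0) (x a 0) (y i 0) (y a 0) => s t u v.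
have [two0 ii] : (2 : C) != 0 /\ ('i * 'i = -1 :> C).
  by rewrite pnatr_eq0 -expr2 sqrCi.
apply/eqP; rewrite -subr_eq0; apply/eqP.
(* [field] treats ['i] as an indeterminate, so the multiple of i^2 + 1 remains. *)
transitivity (2^-1 * u * v * ('i * 'i + 1)); first by field.
by rewrite ii addNr mulr0.
Qed.

(** * Maps in Kraus form *)

Section Kraus.
Variables (d N : nat) (K : 'I_N -> 'M[C]_d) (phi : 'M[C]_d -> 'M[C]_d).
Hypothesis krausE : forall X, phi X = \sum_i K i *m X *m adjmx (K i).

Lemma kraus_linear : linear phi.
Proof.
move=> c X Y; rewrite !krausE scaler_sumr -big_split; apply: eq_bigr => i _ /=.
by rewrite mulmxDr mulmxDl -scalemxAr -scalemxAl.
Qed.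

Lemma kraus_psd X : psd X -> psd (phi X).
Proof. by move=> pX; rewrite krausE; apply: psd_sum => i _; exact: psd_congr. Qed.

(** The columns of [cokermx] span the kernel of phi (perp x), so the conclusion provides a vector
    killed by phi (perp x) but not by phi 1. *)
Lemma UEP_kernel (x y : 'cV[C]_d) :
  trace_preserving phi -> UEP phi ->
  adjmx x *m y = 0 -> sqnorm x = sqnorm y -> x != 0 ->
  phi 1%:M *m cokermx (phi (perp x)) != 0.
Proof.
move=> tp uep xy nxy x0; apply/negP => /eqP ker.
have lphi := kraus_linear.
have [_ phiB phiZ] := linear_morph lphi.
have [amplD amplB amplZ] := linear_morph (@ampl_is_linear C d d phi lphi).
set n := sqnorm x in nxy.
have n0 : 0 <= n := sqnorm_ge0 x.
have yx : adjmx y *m x = 0 by apply: adjmx_inj; rewrite adjmxM adjmxK xy adjmx0.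
have xx : adjmx x *m x = n%:M by rewrite [LHS]mx11_scalar.
have yy : adjmx y *m y = n%:M by rewrite [LHS]mx11_scalar -/(sqnorm y) nxy.
have pr u : psd (u *m adjmx u : 'M[C]_d) by exact: psd_gram.
have p1 : psd (1%:M : 'M[C]_d) by have := psd_gram (1%:M : 'M[C]_d); rewrite adjmx1 mulmx1.
have [c c0 pc] : exists2 c, 0 <= c & psd (c *: phi (perp x) - phi (x *m adjmx x)).
  have [M ME] := psd_factor (kraus_psd p1).
  have [L LE] := psd_factor (kraus_psd (psd_perp x)).
  have := @psd_dominate C _ _ _ L M; rewrite -LE -ME => /(_ ker) [c c0 pc].
  exists (n * c); first by rewrite mulr_ge0.
  have -> : (n * c) *: phi (perp x) - phi (x *m adjmx x)
     = n *: (c *: phi (perp x) - phi 1%:M) + phi (perp x).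
    have perpE : phi (perp x) = n *: phi 1%:M - phi (x *m adjmx x).
      by rewrite -phiZ -phiB scalemx1.
    by rewrite scalerBr scalerA -addrA; congr (_ + _); rewrite perpE addKr.
  by apply: psdD; [exact: psdZ | exact/kraus_psd/psd_perp].
pose P (a b : 'cV[C]_d) := kron (a *m adjmx a) (b *m adjmx b).
have pP a b : psd (P a b) by exact: psd_kron.
set p := x + y; set p' := x - y; set q := x + 'i *: y; set q' := x - 'i *: y.
pose T := P p p' + (P q q' + (P x y + P y x)).
have [b b0 pb] : dominates T (tens x x).
  (* T dominates the product vector of each of its four summands once that summand is moved to the
     front. *)
  have domT a a' A : psd A -> T = P a a' + A -> dominates T (tens a a').
    by move=> pA ->; rewrite /P kron_rank1; exact: dominates_gramD.
  rewrite (tens_square_orthogonal x y); apply: dominatesD; apply: dominatesZ.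
    apply: dominatesD; first by apply: domT (erefl _); do ?apply: psdD.
    by apply: (domT _ _ (P p p' + (P x y + P y x))); [do ?apply: psdD | rewrite /T [LHS]addrCA].
  apply: dominatesD; last apply: dominatesZ.
    apply: (domT _ _ (P p p' + (P q q' + P y x))); first by do ?apply: psdD.
    by rewrite /T [P q q' + _]addrCA [LHS]addrCA.
  apply: (domT _ _ (P p p' + (P q q' + P x y))); first by do ?apply: psdD.
  by rewrite /T [P x y + _]addrC [P q q' + _]addrCA [LHS]addrCA.
(* Equality of the norms makes p orthogonal to p' and q orthogonal to q'. *)
have swT : swap_pairing T = 0.
  rewrite !linearD /= !swap_pairing_rank1 ?addr0 //.
    rewrite /q /q' adjmxD adjmxZ conjCi mulmxDl !mulmxBr -!scalemxAl -!scalemxAr.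
    rewrite xx xy yx yy !scaler0 subr0 sub0r scaleNr opprK scalerA -expr2 sqrCi.
    by rewrite scaleN1r subrr.
  by rewrite /p /p' adjmxD mulmxDl !mulmxBr xx xy yx yy !subr0 sub0r subrr.
pose rho := c *: kron (perp x) (x *m adjmx x) + (b *: T - P x x).
apply: (@UEP_swap_contra C d phi rho) => //.
- apply: psdD; first by apply/psdZ/psd_kron => //; exact: psd_perp.
  by rewrite /P kron_rank1.
(* Since perp x kills x, only the term of [P x x] survives, and the pairing is - |x|^4. *)
- rewrite linearD linearB !linearZ /= swT mulr0 sub0r /P !swap_pairing_kron.
  rewrite /perp mulmxBl mul_scalar_mx mulmxA -(mulmxA x) xx mul_mx_scalar.
  rewrite -scalemxAl subrr mxtrace0 mulr0 sub0r oppr_lt0 mxtraceZ -sqnorm_trace -/n.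
  have n1 : 0 < n by rewrite lt_def n0 andbT; apply: contra x0 => /eqP /sqnorm_eq0 ->.
  by rewrite mulr_gt0.
(* After phi, the negative term joins the first one over the common factor x x^*, where [pc] makes
   the sum positive. *)
have -> : ampl phi rho
    = kron (c *: phi (perp x) - phi (x *m adjmx x)) (x *m adjmx x) + b *: ampl phi T.
  rewrite /rho amplD amplB !amplZ !ampl_kron //.
  by rewrite kronBl kronZl addrCA addrC.
apply: sep_coneD; first exact: sep_cone_kron.
apply: sep_coneZ => //; rewrite /T !amplD /P !ampl_kron //.
by do !apply: sep_coneD; apply: sep_cone_kron => //; exact: kraus_psd.
Qed.

(* A kernel vector h of phi (|x|^2 - x x^* ) annihilates every K_i on the
   complement of x, so h K_i is a multiple of x^*. *)
Lemma UEP_kraus_line (x y : 'cV[C]_d) :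
  trace_preserving phi -> UEP phi ->
  adjmx x *m y = 0 -> sqnorm x = sqnorm y -> x != 0 ->
  exists (h : 'rV_d) (g : 'I_N -> C),
    (forall i, h *m K i = g i *: adjmx x) /\ exists i, g i != 0.
Proof.
move=> tp uep xy nxy x0.
have nx : sqnorm x != 0 by apply: contra x0 => /eqP /sqnorm_eq0 ->.
have kerx := UEP_kernel tp uep xy nxy x0.
set A := phi (perp x) in kerx; set Z := cokermx A in kerx.
have [j zj] : exists j, phi 1%:M *m col j Z != 0.
  apply/existsP; apply: contraR kerx; rewrite negb_exists => /forallP z0.
  apply/eqP/matrixP => i j; rewrite [RHS]mxE.
  have /negPn/eqP := z0 j; rewrite colE mulmxA -colE => /matrixP /(_ i 0).
  by rewrite !mxE.
set z := col j Z in zj; have Az : A *m z = 0 by rewrite /z colE mulmxA mulmx_coker mul0mx.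
pose h := adjmx z.
(* The squared norms of these rows sum to |x|^2 h A z = 0 by [perp_gram]. *)
have hK i : h *m K i *m perp x = 0.
  have : \sum_i \tr ((h *m K i *m perp x) *m adjmx (h *m K i *m perp x)) = 0.
    transitivity (\tr (sqnorm x *: (h *m A *m z))); last first.
      by rewrite -mulmxA Az mulmx0 scaler0 mxtrace0.
    rewrite /A krausE mulmx_sumr mulmx_suml scaler_sumr linear_sum; apply: eq_bigr => k _.
    congr (\tr _); rewrite !adjmxM adjmxK mulmxA -(mulmxA _ _ (adjmx (perp x))) -perp_gram.
    by rewrite -scalemxAr -!scalemxAl !mulmxA.
  move/psumr_eq0P => s0; apply: trace_gram_eq0; apply: s0 => // k _.
  exact: trace_gram_ge0.
exists h, (fun i => (h *m K i *m x) 0 0 / sqnorm x); split.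
  move=> i; have := hK i; rewrite {1}/perp mulmxBr mul_mx_scalar => /subr0_eq.
  rewrite mulmxA [h *m K i *m x]mx11_scalar mul_scalar_mx => hx.
  by rewrite mulrC -scalerA mxE -hx scalerA mulVf ?scale1r.
(* If all g i vanished, then z^* K_i = 0 for all i, and phi 1 would kill z. *)
apply/existsP; apply: contraR zj; rewrite negb_exists => /forallP g0.
have hK0 i : h *m K i = 0.
  have := hK i; rewrite {1}/perp mulmxBr mul_mx_scalar mulmxA => /subr0_eq.
  rewrite [h *m K i *m x]mx11_scalar mul_scalar_mx => hx.
  have := g0 i; rewrite negbK mulf_eq0 invr_eq0 (negPf nx) orbF => /eqP gi.
  by move: hx; rewrite gi scale0r => /eqP; rewrite scaler_eq0 (negPf nx) => /eqP.
rewrite krausE mulmx_suml big1 // => i _.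
have /(congr1 (@adjmx C _ _)) := hK0 i; rewrite adjmxM adjmxK adjmx0 => Kz.
by rewrite -mulmxA Kz mulmx0.
Qed.

End Kraus.
End Channel.

(** * Unitarity *)

Section Main.
Variable C : numClosedFieldType.

(** Choi's argument: complete positivity makes the image of w w^* positive, for w the sum of the e_i
    (x) e_i. The columns of a Gram factor, reshaped as matrices, are the Kraus operators. *)
Lemma kraus_exists d (phi : 'M[C]_d -> 'M[C]_d) :
  linear phi -> completely_positive phi ->
  exists N (K : 'I_N -> 'M[C]_d),
    forall X, phi X = \sum_i K i *m X *m adjmx (K i).
Proof.
move=> lphi cp.
pose w : 'cV[C]_(d * d) := (mxvec 1%:M)^T.
have wE i a : w (mxvec_index i a) 0 = (i == a)%:R by rewrite mxE mxvecE mxE.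
have [M ME] := psd_factor (cp _ _ (psd_gram w)).
exists _, (fun k => \matrix_(i, a) M (mxvec_index i a) k) => X.
set K := (K in \sum_i K i *m _ *m _).
pose psi X := \sum_i K i *m X *m adjmx (K i).
have lpsi : linear psi by exact: (kraus_linear (fun X => erefl (psi X))).
(* The blocks of w w^* are the matrix units, so the Choi matrix records phi on a basis. *)
have phi_delta a b : phi (delta_mx a b) = psi (delta_mx a b).
  have -> : delta_mx a b = blk (w *m adjmx w) a b.
    by apply/matrixP => i j; rewrite !mxE big_ord1 adjmxE !wE rmorph_nat -natrM mulnb.
  apply/matrixP => i j; rewrite -amplE ME mxE summxE; apply: eq_bigr => k _.
  have -> : blk (w *m adjmx w) a b = delta_mx a 0 *m adjmx (delta_mx b 0 : 'cV_d).
    apply/matrixP => i' j'; rewrite !mxE !big_ord1 !adjmxE !wE !mxE !andbT.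
    by rewrite !rmorph_nat.
  by rewrite !mulmxA -mulmxA -adjmxM -!colE [RHS]mxE big_ord1 !adjmxE !mxE.
have [phiD _ phiZ] := linear_morph lphi; have [psiD _ psiZ] := linear_morph lpsi.
have sumE (f : 'M[C]_d -> 'M[C]_d) : {morph f : u v / u + v} ->
    (forall k, {morph f : u / k *: u}) ->
    f X = \sum_i \sum_j X i j *: f (delta_mx i j).
  move=> fD fZ; have f0 := fZ 0 0; rewrite !scale0r in f0.
  rewrite {1}[X]matrix_sum_delta (big_morph f fD f0); apply: eq_bigr => i _.
  by rewrite (big_morph f fD f0); apply: eq_bigr => j _; rewrite fZ.
rewrite -/(psi X) (sumE phi) // (sumE psi) //.
by apply: eq_bigr => i _; apply: eq_bigr => j _; rewrite phi_delta.
Qed.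

(** A separable decomposition of the image pulls back along X -> U^* X U to one of rho. *)
Lemma unitary_UEP d (phi : 'M[C]_d -> 'M[C]_d) :
  quantum_channel phi -> unitary_evolution phi -> UEP phi.
Proof.
move=> [lphi cp tp] [U [UU phiE]] m rho [[prho tr1] nsep].
have UU' := mulmx1C UU.
split; first by split; [exact: cp | rewrite trace_ampl].
move=> [k [p [rA [rB [p0 p1 st rhoE]]]]]; apply: nsep.
pose psi (X : 'M[C]_d) := adjmx U *m X *m U.
have phiK : cancel phi psi.
  by move=> X; rewrite /psi phiE !mulmxA UU' mul1mx -mulmxA UU' mulmx1.
have lpsi : linear psi.
  by move=> c X Y; rewrite /psi mulmxDr mulmxDl -scalemxAr -scalemxAl.
have [amD _ amZ] := linear_morph (@ampl_is_linear C d m psi lpsi).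
have am0 := amZ 0 0; rewrite !scale0r in am0.
exists k, p, (fun l => psi (rA l)), rB; split=> // [l|].
  have [[pA trA] sB] := st l; split=> //; split.
    by have := psd_congr (adjmx U) pA; rewrite adjmxK.
  by rewrite /psi mxtrace_mulC mulmxA UU mul1mx.
rewrite -(ampl_cancel rho phiK) rhoE (big_morph _ amD am0).
by apply: eq_bigr => l _; rewrite amZ ampl_kron.
Qed.

(** By cyclicity the hypothesis reads tr (U^* U X) = tr X; testing it on matrix units gives U^* U =
    1. *)
Lemma trace_preserving_congr_unitary d (U : 'M[C]_d) :
  (forall X, \tr (U *m X *m adjmx U) = \tr X) -> U *m adjmx U = 1%:M.
Proof.
move=> tp; apply: mulmx1C; apply/matrixP => a b.
have trd (M : 'M[C]_d) : \tr (M *m delta_mx b a) = M a b.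
  rewrite -(mul_delta_mx (0 : 'I_1)) mulmxA mxtrace_mulC mulmxA -colE -rowE.
  by rewrite /mxtrace big_ord1 !mxE.
by rewrite -trd -mulmxA mxtrace_mulC tp -[delta_mx b a]mul1mx trd.
Qed.

Lemma UEP_unitary d (phi : 'M[C]_d -> 'M[C]_d) :
  quantum_channel phi -> UEP phi -> unitary_evolution phi.
Proof.
move=> [lphi cp tp] uep.
(* Orthogonal vectors of equal nonzero norm need dimension at least 2; in dimension 1, trace
   preservation makes phi the identity. *)
case: d phi lphi cp tp uep => [|[|d]] phi lphi cp tp uep.
- by exists 0; split=> [|X]; apply/matrixP => -[].
- exists 1%:M; rewrite adjmx1 mulmx1; split=> // X; rewrite mulmx1 mul1mx.
  by have := tp X; rewrite /mxtrace !big_ord1 => tX; apply/matrixP => i j; rewrite !ord1.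
have [N [K krausE]] := kraus_exists lphi cp.
pose e (j : 'I_d.+2) : 'cV[C]_d.+2 := delta_mx j 0.
have eE j i k : e j i k = (i == j)%:R by rewrite mxE [k]ord1 andbT.
have dotE j k : adjmx (e j) *m e k = (j == k)%:R%:M.
  rewrite adjmx_delta -rowE; apply/matrixP => a b.
  by rewrite !ord1 !mxE !eqxx andbT mulr1n.
have sqe j : sqnorm (e j) = 1 by rewrite /sqnorm dotE eqxx mxE.
have e0 j : e j != 0.
  by apply: contra_eq_neq (sqe j) => ->; rewrite /sqnorm mulmx0 mxE eq_sym oner_eq0.
have basis j : exists hg : 'rV[C]_d.+2 * ('I_N -> C),
    (forall i, hg.1 *m K i = hg.2 i *: adjmx (e j)) /\ exists i, hg.2 i != 0.
  pose k : 'I_d.+2 := lift j ord0.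
  have jk : j != k by exact: neq_lift.
  have jk0 : adjmx (e j) *m e k = 0 by rewrite dotE (negPf jk) raddf0.
  have njk : sqnorm (e j) = sqnorm (e k) by rewrite !sqe.
  have [h [g hg]] := UEP_kraus_line krausE tp uep jk0 njk (e0 j).
  by exists (h, g).
have [hg {}basis] := fin_all_exists basis.
pose g j i := (hg j).2 i.
pose G : 'M[C]_d.+2 := \matrix_(j, k) (hg j).1 0 k.
have rowG j : row j G = (hg j).1 by apply/rowP => k; rewrite !mxE.
have GK i : G *m K i = diag_mx (\row_j g j i).
  apply/row_matrixP => j; rewrite row_mul rowG (basis j).1 row_diag_mx mxE.
  by rewrite adjmx_delta.
have unitG : G \in unitmx.
  (* If v G = 0, then v_j g_j(i) = 0 for every i, while some g_j(i) is nonzero. *)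
  rewrite -row_free_unit; apply/inj_row_free => v vG; apply/rowP => j.
  have [i gi] := (basis j).2.
  have : v *m G *m K i = 0 by rewrite vG mul0mx.
  rewrite -mulmxA GK mul_mx_diag => /rowP /(_ j); rewrite !mxE => /eqP.
  by rewrite mulf_eq0 (negPf gi) orbF => /eqP.
have ratio k : exists t, forall i, g k i = t * g ord0 i.
  have [->|k0] := eqVneq k ord0; first by exists 1 => i; rewrite mul1r.
  have e0k := dotE ord0 k; have ek0 := dotE k ord0; move: e0k ek0.
  rewrite (negPf k0) [ord0 == k]eq_sym (negPf k0) !raddf0 => e0k ek0.
  have xy : adjmx (e ord0 + e k) *m (e ord0 - e k) = 0.
    by rewrite adjmxD mulmxDl !mulmxBr e0k ek0 !dotE !eqxx subr0 sub0r subrr.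
  have nxy : sqnorm (e ord0 + e k) = sqnorm (e ord0 - e k).
    rewrite /sqnorm adjmxD adjmxB mulmxDl mulmxBl !(mulmxBr, mulmxDr) e0k ek0.
    by rewrite subr0 sub0r opprK addr0 add0r.
  have x0 : e ord0 + e k != 0.
    apply/eqP => /matrixP /(_ ord0 0); rewrite mxE !eE eqxx eq_sym (negPf k0) mxE.
    by move/eqP; rewrite addr0 oner_eq0.
  have [h [c [hK [i0 ci0]]]] := UEP_kraus_line krausE tp uep xy nxy x0.
  (* In the basis of rows of G, h has coordinates b, so h K_i = c_i x^* reads b_j g_j(i) = c_i
     conj(x_j). Positions 0 and k both give c_i. *)
  pose b := h *m invmx G.
  have bE j i : b 0 j * g j i = c i * (adjmx (e ord0 + e k)) 0 j.
    have := hK i; rewrite -[h](mulmxKV unitG) -/b -mulmxA GK mul_mx_diag.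
    by move=> /rowP /(_ j); rewrite !mxE.
  have b0 i : b 0 ord0 * g ord0 i = c i.
    by rewrite bE adjmxE mxE !eE eqxx eq_sym (negPf k0) addr0 conjC1 mulr1.
  have bk i : b 0 k * g k i = c i.
    by rewrite bE adjmxE mxE !eE eqxx (negPf k0) add0r conjC1 mulr1.
  have bk0 : b 0 k != 0 by apply: contra_neq ci0 => bk0; rewrite -bk bk0 mul0r.
  by exists (b 0 ord0 / b 0 k) => i; rewrite mulrAC b0 -(bk i) mulrAC mulfV ?mul1r.
have [t tE] := fin_all_exists ratio.
pose V := invmx G *m diag_mx (\row_j t j).
have KV i : K i = g ord0 i *: V.
  rewrite -[K i](mulKmx unitG) GK /V scalemxAr; congr (_ *m _).
  by apply/matrixP => j k; rewrite !mxE tE mulrC mulrnAr.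
(* All K_i are multiples of V, so the Kraus sum collapses to s V X V^*. *)
pose s := \sum_i `|g ord0 i| ^+ 2.
have s0 : 0 <= s by apply: sumr_ge0 => i _; rewrite exprn_ge0.
exists (sqrtC s *: V).
have phiE X : phi X = (sqrtC s *: V) *m X *m adjmx (sqrtC s *: V).
  rewrite krausE adjmxZ -!scalemxAl -scalemxAr scalerA geC0_conj ?sqrtC_ge0 //.
  rewrite -expr2 sqrtCK /s scaler_suml; apply: eq_bigr => i _.
  by rewrite KV adjmxZ -!scalemxAl -scalemxAr scalerA normCK.
split=> //; apply: trace_preserving_congr_unitary => X.
by rewrite -phiE tp.
Qed.

End Main.

Theorem mainTheorem3 (C : numClosedFieldType) (d : nat) (phi : 'M[C]_d -> 'M[C]_d) :
  quantum_channel phi -> (UEP phi <-> unitary_evolution phi).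
Proof. by move=> qc; split; [exact: UEP_unitary | exact: unitary_UEP]. Qed.
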